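(* Let $G=(V,E,I,\iota,\sigma)$ be a bidirected graph in which every connected component contains at least one adjacency, with $V$ linearly ordered, and with Laplacian matrix $\mathbf{L}_G$. Let $U,W\subseteq V$ with $|U|=|W|$ and linear orderings $\mathbf{u}$ and $\mathbf{w}$ (induced from $V$), and let $[\mathbf{L}_G]_{(\mathbf{u};\mathbf{w})}$ be the matrix formed from $\mathbf{L}_G$ by deleting the rows corresponding to the vertices in $U$ and the columns corresponding to the vertices in $W$. Let $G'$ be the adjacency completion of $G$. Then 1. $\mathrm{perm}([\mathbf{L}_{G}]_{(\mathbf{u};\mathbf{w})})=\sum_{c\in\widehat{\mathfrak{C}}_{\neq 0}(\mathbf{u};\mathbf{w};G')}(-1)^{on(c)+nn(c)}$, 2. $\det([\mathbf{L}_{G}]_{(\mathbf{u};\mathbf{w})})=\sum_{c\in\widehat{\mathfrak{C}}_{\neq 0}(\mathbf{u};\mathbf{w};G')}\varepsilon(c)\cdot(-1)^{on(c)+nn(c)}$, where $\varepsilon(c)=(-1)^{\mathrm{inv}(c)}$ and $\mathrm{inv}(c)$ is the number of inversions of the bijection $V\setminus U\to V\setminus W$, $v\mapsto c(h_v)$, with respect to the linear order on $V$.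
   Context: A bidirected graph is a quintuple $G=(V,E,I,\iota,\sigma)$ where $V,E,I$ are disjoint finite sets (vertices, edges, incidences), $V$ nonempty, $\iota:I\to V\times E$ and $\sigma:I\to\{+1,-1\}$ are functions, and every edge $e\in E$ belongs to exactly two incidences, i.e. there are exactly two $i\in I$ whose $\iota(i)$ has second coordinate $e$. Parallel edges and loops are allowed. Let $\overrightarrow{P}_1$ be the directed path of length 1 with tail $t$ and head $h$. An incidence preserving map $\overrightarrow{P}_1\to G$ is the same as a sequence $(v,i,e,j,w)$ with $\iota(i)=(v,e)$, $\iota(j)=(w,e)$ ($t\mapsto v$, $h\mapsto w$). It is a backstep if $i=j$, and a directed adjacency if $i\ne j$ (a loop if also $v=w$). The sign of a weak walk of length $k$ (a concatenation of $k$ such sequences) with incidence sequence $i_1,\dots,i_{2k}$ is $(-1)^k\prod_{h=1}^{2k}\sigma(i_h)$. The Laplacian $\mathbf{L}_G$ is the $V\times V$ matrix whose $(v,w)$-entry is $\sum_\omega -sgn(\omega)$ over all incidence preserving maps $\omega:\overrightarrow{P}_1\to G$ with tail sent to $v$ and head sent to $w$. A contributor of $G$ is an incidence preserving map $c:\coprod_{v\in V}\overrightarrow{P}_1\to G$ (one copy $(\overrightarrow{P}_1)_v$ with tail $t_v$ and head $h_v$ for each $v$) with $c(t_v)=v$ for all $v$ and $\{c(h_v)\mid v\in V\}=V$. The adjacency completion $G'$ of $G$ is obtained by adding, for every pair of distinct non-adjacent vertices of $G$, one new edge with two new incidences joining them; the function $\sigma'$ equals $\sigma$ on $I$ and equals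 $0$ on the new incidences. Contributors and signs in $G'$ are defined by the same formulas. Write $\mathbf{u}=(u_1,\dots,u_k)$ and $\mathbf{w}=(w_1,\dots,w_k)$ for the elements of $U$ and $W$ listed in the order of $V$. $\mathfrak{C}(\mathbf{u};\mathbf{w};G')$ is the set of contributors $c$ of $G'$ with $c(h_{u_i})=w_i$ for all $i$. $\widehat{\mathfrak{C}}(\mathbf{u};\mathbf{w};G')$ is the set of maps on $\coprod_{v\in V\setminus U}\overrightarrow{P}_1$ obtained from elements of $\mathfrak{C}(\mathbf{u};\mathbf{w};G')$ by removing, for each $i$, the image of $(\overrightarrow{P}_1)_{u_i}$ (the adjacency or backstep from $u_i$ to $w_i$). The sign of such a sub-contributor is the product of the signs of its weak walks (computed with $\sigma'$), and $\widehat{\mathfrak{C}}_{\ne0}(\mathbf{u};\mathbf{w};G')$ is the subset of elements with non-zero sign. For such a $c$, the bijection $v\mapsto c(h_v)$ from $V\setminus U$ to $V\setminus W$ decomposes its image into vertex-disjoint directed paths and directed circles; discard the circles consisting of a single backstep (a loop counts as a circle of length 1, and a closed weak walk of length 2 formed by two directed adjacencies as a circle of length 2). $on(c)$ is the number of remaining components of odd length (length = number of copies of $\overrightarrow{P}_1$), and $nn(c)$ the number of remaining components whose sign as a weak walk is negative. *)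

(* Defs.v *)
From HB Require Import structures.
From mathcomp Require Import all_boot all_order all_algebra all_fingroup.

Set Implicit Arguments.
Unset Strict Implicit.
Unset Printing Implicit Defensive.

Import Order.TTheory GRing.Theory Num.Theory.

Local Open Scope ring_scope.

(* The sign function is integer-valued so that the same notions apply both to
   bidirected graphs (signs +1, -1) and to their adjacency completions, whose
   added incidences have sign 0. *)
Record signed_incidence (V : finType) := SignedIncidence {
  edge : finType;
  incidence : finType;
  iota : incidence -> V * edge;
  sigma : incidence -> int
}.

Record bidirected_graph (V : finType) := BidirectedGraph {
  bg_incidence :> signed_incidence V;
  bg_nonempty : (0 < #|V|)%N;
  bg_edge2 : forall e : edge bg_incidence,
    #|[set i : incidence bg_incidence | (iota i).2 == e]| = 2%N;
  bg_sign : forall i : incidence bg_incidence, sigma i = 1 \/ sigma i = -1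
}.

Section WeakWalks.
Variables (V : finType) (G : signed_incidence V).

(* Incidence preserving maps from the directed path of length 1: sequences
   (v, i, e, j, w) with iota i = (v, e) and iota j = (w, e). *)
Definition is_path1 (p : V * incidence G * edge G * incidence G * V) : bool :=
  let: (v, i, e, j, w) := p in (iota i == (v, e)) && (iota j == (w, e)).

Record path1_map := Path1Map {
  path1_seq : V * incidence G * edge G * incidence G * V;
  path1_seqP : is_path1 path1_seq
}.
HB.instance Definition _ := [isSub for path1_seq].
HB.instance Definition _ := [Finite of path1_map by <:].

Definition tail_vertex (p : path1_map) : V := (path1_seq p).1.1.1.1.
Definition tail_inc (p : path1_map) : incidence G := (path1_seq p).1.1.1.2.
Definition head_inc (p : path1_map) : incidence G := (path1_seq p).1.2.
Definition head_vertex (p : path1_map) : V := (path1_seq p).2.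

Definition backstep (p : path1_map) : bool := tail_inc p == head_inc p.

(* The sign of the concatenation of the members of s; it does not depend on
   the order of s, nor is consecutiveness of its members needed to define it. *)
Definition walk_sign (s : seq path1_map) : int :=
  (-1) ^+ size s *
  \prod_(i <- flatten [seq [:: tail_inc p; head_inc p] | p <- s]) sigma i.

Definition adjacent (v w : V) : bool :=
  [exists p : path1_map,
    [&& ~~ backstep p, tail_vertex p == v & head_vertex p == w]].

Definition component (v : V) : {set V} := [set w | connect adjacent v w].

Definition components_have_adjacency : Prop :=
  forall v : V, exists2 p : path1_map,
    ~~ backstep p &
    (tail_vertex p \in component v) && (head_vertex p \in component v).

Definition laplacian_entry (v w : V) : int :=
  \sum_(p : path1_map | (tail_vertex p == v) && (head_vertex p == w))
    - walk_sign [:: p].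

Definition contributor (c : {ffun V -> path1_map}) : bool :=
  [forall v, tail_vertex (c v) == v] &&
  ([set head_vertex (c v) | v : V] == [set: V]).

Definition partial_map (U : {set V}) :=
  {ffun {v : V | v \notin U} -> path1_map}.

Definition remove_map (U : {set V}) (c : {ffun V -> path1_map}) :
  partial_map U := [ffun x => c (val x)].

Section Components.
Variables (U : {set V}) (c : partial_map U).

(* The copies of the path of length 1 over x and y meet at a vertex. *)
Definition share_vertex (x y : {v : V | v \notin U}) : bool :=
  (head_vertex (c x) == val y) || (head_vertex (c y) == val x).

(* Each directed path or circle in the image of c is represented by the set of
   copies of the path of length 1 (indexed by their tails) that compose it. *)
Definition walk_components : {set {set {v : V | v \notin U}}} :=
  [set [set y | connect share_vertex x y] | x : {v : V | v \notin U}].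

Definition component_sign (K : {set {v : V | v \notin U}}) : int :=
  walk_sign [seq c x | x <- enum K].

Definition partial_sign : int :=
  \prod_(K in walk_components) component_sign K.

Definition backstep_circle (K : {set {v : V | v \notin U}}) : bool :=
  [exists x, (K == [set x]) && backstep (c x)].

Definition odd_number : nat :=
  #|[set K in walk_components | ~~ backstep_circle K & odd #|K|]|.

Definition negative_number : nat :=
  #|[set K in walk_components | ~~ backstep_circle K & component_sign K < 0]|.

End Components.

End WeakWalks.

Section Ordered.
Variables (d : Order.disp_t) (V : finOrderType d).

(* Order.enum_val lists the elements of a set increasingly. *)

Definition laplacian (G : signed_incidence V) : 'M[int]_#|V| :=
  \matrix_(i, j) laplacian_entry G (Order.enum_val i) (Order.enum_val j).

Lemma card_setC_eq (U W : {set V}) : #|U| = #|W| -> #|~: U| = #|~: W|.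
Proof.
by move=> h; apply/eqP; rewrite -(eqn_add2l #|U|) cardsC h cardsC.
Qed.

Definition delete_rows_cols (U W : {set V}) (hUW : #|U| = #|W|)
    (A : 'M[int]_#|V|) : 'M[int]_#|~: U| :=
  mxsub (fun i => Order.enum_rank (Order.enum_val i))
        (fun j => Order.enum_rank
                    (Order.enum_val (cast_ord (card_setC_eq hUW) j)))
        A.

Section Completion.
Variable G : signed_incidence V.

(* One new edge for each unordered pair {v, w} of distinct non-adjacent
   vertices, encoded by the pair (v, w) with v < w. *)
Definition new_edge :=
  {p : V * V | (p.1 < p.2)%O && ~~ adjacent G p.1 p.2}.

Definition completion_iota (i : incidence G + new_edge * bool) :
    V * (edge G + new_edge) :=
  match i with
  | inl i0 => ((iota i0).1, inl (iota i0).2)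
  | inr (e, b) => (if b then (val e).2 else (val e).1, inr e)
  end.

Definition completion_sigma (i : incidence G + new_edge * bool) : int :=
  if i is inl i0 then sigma i0 else 0.

Definition adjacency_completion : signed_incidence V :=
  SignedIncidence completion_iota completion_sigma.

End Completion.

Section SubContributors.
Variables (H : signed_incidence V) (U W : {set V}) (hUW : #|U| = #|W|).

Definition contributors : {set {ffun V -> path1_map H}} :=
  [set c | contributor c &
    [forall i : 'I_#|U|,
      head_vertex (c (Order.enum_val i)) == Order.enum_val (cast_ord hUW i)]].

Definition subcontributors : {set partial_map H U} :=
  [set remove_map U c | c in contributors].

Definition nonzero_subcontributors : {set partial_map H U} :=
  [set c in subcontributors | partial_sign c != 0].

End SubContributors.

Definition inversions (H : signed_incidence V) (U : {set V})
    (c : partial_map H U) : nat :=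
  #|[set p : {v : V | v \notin U} * {v : V | v \notin U} |
      (val p.1 < val p.2)%O && (head_vertex (c p.2) < head_vertex (c p.1))%O]|.

End Ordered.

Definition permanent (R : comPzRingType) (n : nat) (A : 'M[R]_n) : R :=
  \sum_(s : 'S_n) \prod_(i < n) A i (s i).

(* Main.v *)
(* Expanding each Laplacian entry over the maps of a path of length 1 turns a
   product along a bijection s from V \ U to V \ W into a sum, over the families
   of such maps realizing s, of the product of their negated signs.  Incidences
   of sign 0 contribute nothing, so this may be done in G' instead of G, and in
   G' every such family extends to a contributor, since a path from u_i to w_i
   always exists.  Grouping the factors by components, a component K contributes
   (-1)^|K| times its sign, and a single backstep contributes 1. *)

Require Import Defs.
From mathcomp Require Import all_boot all_order all_algebra all_fingroup.

Set Implicit Arguments.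
Unset Strict Implicit.
Unset Printing Implicit Defensive.

Import Order.TTheory GRing.Theory Num.Theory.

Local Open Scope ring_scope.

(* A permutation of the nodes multiplies the Vandermonde product by its sign;
   factor by factor it changes only the signs at the inversions. *)
Lemma odd_perm_inversions n (s : 'S_n) :
  (-1) ^+ s =
  (-1) ^+ #|[set p : 'I_n * 'I_n | (p.1 < p.2)%N && (s p.2 < s p.1)%N]| :> int.
Proof.
pose D (t : 'S_n) : int :=
  \prod_(p : 'I_n * 'I_n | (p.1 < p.2)%N) ((t p.2)%:R - (t p.1)%:R).
pose a (t : 'S_n) : 'rV[int]_n := \row_i (t i)%:R.
have detD t : \det (Vandermonde n (a t)) = D t.
  rewrite det_Vandermonde pair_big_dep; apply: eq_bigr => -[i j] _.
  by rewrite !mxE.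
have Ds : D s = (-1) ^+ s * D 1%g.
  rewrite -!detD.
  have -> : Vandermonde n (a s) = col_perm s (Vandermonde n (a 1%g)).
    by apply/matrixP => i j; rewrite !mxE perm1.
  by rewrite col_permE det_mulmx det_perm mulrC odd_permV.
have normD (t : 'S_n) : D t =
  (-1) ^+ #|[set p : 'I_n * 'I_n | (p.1 < p.2)%N && (t p.2 < t p.1)%N]|
    * `|D t|.
  rewrite /D normr_prod [LHS](eq_bigr (fun p : 'I_n * 'I_n =>
    (if (t p.2 < t p.1)%N then -1 else 1) * `|(t p.2)%:R - (t p.1)%:R : int|)).
    rewrite big_split /= -big_mkcondr /= prodr_const; congr (_ ^+ _ * _).
    by apply: eq_card => p; rewrite inE.
  move=> p _; case: ltnP => h.
    by rewrite ltr0_norm ?mulN1r ?opprK // subr_lt0 ltr_nat.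
  by rewrite ger0_norm ?mul1r // subr_ge0 ler_nat.
have D0 : D s != 0.
  apply/prodf_neq0 => p lt_p; rewrite subr_eq0 eqr_nat.
  by rewrite (inj_eq val_inj) (inj_eq perm_inj) -(inj_eq val_inj) /= gtn_eqF.
have nD : `|D s| = `|D 1%g| by rewrite Ds normrM normr_sign mul1r.
have D1 : D 1%g = `|D 1%g|.
  rewrite ger0_norm // prodr_ge0 // => p lt_p.
  by rewrite !perm1 subr_ge0 ler_nat ltnW.
(* [D s] and [D 1] have the same absolute value and [D 1] is positive, so [normD] exhibits [D s] as
   a sign times [D 1], which cancels. *)
apply: (mulIf (x := D 1%g)).
  by move: D0; rewrite Ds mulf_eq0 signr_eq0.
by rewrite -Ds normD nD D1 normr_id.
Qed.

(** * Signs of paths, walks and components *)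

Section Paths.
Variables (V : finType) (H : signed_incidence V).

Lemma path1P (p : path1_map H) :
  [/\ (Defs.iota (tail_inc p)).1 = tail_vertex p,
      (Defs.iota (head_inc p)).1 = head_vertex p &
      (Defs.iota (tail_inc p)).2 = (Defs.iota (head_inc p)).2].
Proof.
case: p => [[[[[v i] e] j] w]] h.
rewrite /tail_inc /head_inc /tail_vertex /head_vertex /=.
by move: h => /andP[/eqP -> /eqP ->].
Qed.

(** [iota] recovers both vertices and the edge. With [path1_of_inc], this encodes the maps as the
    pairs of incidences on a common edge. *)
Lemma path1_inc_inj :
  injective (fun p : path1_map H => (tail_inc p, head_inc p)).
Proof.
move=> [[[[[v i] e] j] w] h] [[[[[v' i'] e'] j'] w'] h'].
rewrite /tail_inc /head_inc /= => -[eq_i eq_j]; apply: val_inj => /=.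
move: h h'; rewrite /= -{}eq_i -{}eq_j.
by case/andP=> /eqP -> /eqP -> /andP[/eqP[-> ->] /eqP[->]].
Qed.

Lemma path1_of_inc (i j : incidence H) :
  (Defs.iota i).2 = (Defs.iota j).2 ->
  exists2 p : path1_map H, tail_inc p = i & head_inc p = j.
Proof.
move=> e.
have h : is_path1 ((Defs.iota i).1, i, (Defs.iota i).2, j, (Defs.iota j).1).
  by rewrite /is_path1 {2}e -!surjective_pairing !eqxx.
by exists (Path1Map h).
Qed.

Lemma walk_sign1 (p : path1_map H) :
  - walk_sign [:: p] = sigma (tail_inc p) * sigma (head_inc p).
Proof.
by rewrite /walk_sign /= expr1 !big_cons big_nil mulr1 mulN1r opprK.
Qed.

(** In this form the incidences of sign 0 drop out term by term. *)
Lemma laplacian_entryE (v w : V) :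
  laplacian_entry H v w =
  \sum_(i : incidence H | (Defs.iota i).1 == v)
    \sum_(j : incidence H | ((Defs.iota j).1 == w) &&
                            ((Defs.iota i).2 == (Defs.iota j).2))
      sigma i * sigma j.
Proof.
rewrite pair_big_dep /=.
pose A := [pred p : path1_map H | (tail_vertex p == v) && (head_vertex p == w)].
transitivity (\sum_(q in [set (tail_inc p, head_inc p) | p in A])
                sigma q.1 * sigma q.2).
  rewrite big_imset /=; last by move=> p q _ _; apply: path1_inc_inj.
  by apply: eq_bigr => p _; rewrite walk_sign1.
apply: eq_bigl => -[i j] /=; apply/imsetP/idP.
  case=> p /andP[/eqP <- /eqP <-] [-> ->].
  by case: (path1P p) => -> -> ->; rewrite !eqxx.
case/and3P=> /eqP iv /eqP jw /eqP /path1_of_inc[p pi pj].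
exists p; last by rewrite pi pj.
by case: (path1P p); rewrite pi pj iv jw inE => <- <- _; rewrite !eqxx.
Qed.

Lemma walk_signE (s : seq (path1_map H)) :
  walk_sign s = \prod_(p <- s) walk_sign [:: p].
Proof.
elim: s => [|p s IH]; first by rewrite big_nil /walk_sign /= big_nil mulr1.
rewrite big_cons -IH /walk_sign /= !big_cons big_nil mulr1 expr1 exprS.
by rewrite -!mulrA; congr (_ * _); rewrite !mulrA ![_ * (-1) ^+ _]mulrC !mulrA.
Qed.

Variables (U : {set V}) (c : partial_map H U).

Lemma component_signE (K : {set {v : V | v \notin U}}) :
  component_sign c K = \prod_(x in K) walk_sign [:: c x].
Proof. by rewrite /component_sign walk_signE big_map big_enum. Qed.

Lemma walk_components_partition : partition (walk_components c) setT.
Proof.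
have symc : connect_sym (share_vertex c).
  by apply: sym_connect_sym => x y; rewrite /share_vertex orbC.
have -> : walk_components c =
    equivalence_partition (connect (share_vertex c)) setT.
  apply/setP => K; apply/imsetP/imsetP => -[x _ ->]; exists x => //;
    by apply/setP => y; rewrite !inE.
apply: equivalence_partitionP => x y z _ _ _.
split=> [|xy]; first exact: connect0.
exact: (same_connect symc).
Qed.

Lemma big_walk_components (F : {v : V | v \notin U} -> int) :
  \prod_x F x = \prod_(K in walk_components c) \prod_(x in K) F x.
Proof.
rewrite -(set_partition_big _ walk_components_partition).
by apply: eq_bigl => x; rewrite inE.
Qed.

Lemma partial_signE : partial_sign c = \prod_x walk_sign [:: c x].
Proof.
rewrite big_walk_components; apply: eq_bigr => K _; exact: component_signE.
Qed.

Hypothesis sigma01 : forall i : incidence H, sigma i \in [:: 0; 1; -1].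

Lemma walk_sign01 (p : path1_map H) : walk_sign [:: p] \in [:: 0; 1; -1].
Proof.
rewrite -[walk_sign _]opprK walk_sign1.
move: (sigma01 (tail_inc p)) (sigma01 (head_inc p)).
by rewrite !inE => /or3P[] /eqP -> /or3P[] /eqP ->.
Qed.

(** Each factor is 0, 1 or -1, so a nonzero product has absolute value 1. *)
Lemma component_sign_norm K : component_sign c K != 0 ->
  component_sign c K = (-1) ^+ (component_sign c K < 0)%R.
Proof.
move=> nz; rewrite {1}[component_sign c K]numEsign.
suff -> : `|component_sign c K| = 1 by rewrite mulr1.
rewrite component_signE normr_prod big1 // => x xK.
move: nz; rewrite component_signE => /prodf_neq0 /(_ x xK).
by move: (walk_sign01 (c x)); rewrite !inE => /or3P[] /eqP ->.
Qed.

Lemma partial_weightE : partial_sign c != 0 ->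
  \prod_x - walk_sign [:: c x] = (-1) ^+ (odd_number c + negative_number c).
Proof.
move=> /prodf_neq0 nz; rewrite big_walk_components.
(* Turning counts into products lets both sides be compared one component at a time. *)
have powE (P : pred {set {v : V | v \notin U}}) :
  (-1) ^+ #|[set K in walk_components c | P K]| =
  \prod_(K in walk_components c) (-1) ^+ P K :> int.
  rewrite (eq_bigr (fun K => if P K then -1 else 1)) => [|K _];
    last by case: (P K).
  rewrite -big_mkcondr /= prodr_const; congr (_ ^+ _).
  by apply: eq_card => K; rewrite inE.
rewrite exprD !powE -big_split /=; apply: eq_bigr => K Kc.
have := component_sign_norm (nz K Kc).
have [bs _|_ /= sg] /= := boolP (backstep_circle c K).
  (* A discarded backstep uses one incidence twice: its weight is the square of a nonzero sign,
     namely 1. *)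
  case/existsP: bs (nz K Kc) => x /andP[/eqP -> /eqP hx].
  rewrite component_signE !big_set1 walk_sign1 => nzx; rewrite -hx mulr1.
  have : sigma (tail_inc (c x)) != 0.
    by apply: contraNneq nzx => s0; rewrite -oppr_eq0 walk_sign1 s0 mul0r.
  by move: (sigma01 (tail_inc (c x))); rewrite !inE => /or3P[] /eqP ->.
(* The parity of [#|K|] accounts for the minus sign carried by each factor. *)
rewrite -sg signr_odd component_signE -prodr_const -big_split /=.
by apply: eq_bigr => x _; rewrite mulN1r.
Qed.

End Paths.

(** * The adjacency completion *)

Section Completion.
Variables (d : Order.disp_t) (V : finOrderType d) (G : signed_incidence V).

Lemma completion_sigma01 :
    (forall i : incidence G, sigma i = 1 \/ sigma i = -1) ->
  forall i : incidence (adjacency_completion G), sigma i \in [:: 0; 1; -1].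
Proof. by move=> sG [i|[e b]] //=; case: (sG i) => ->. Qed.

Lemma laplacian_completion : laplacian (adjacency_completion G) = laplacian G.
Proof.
apply/matrixP => i j; rewrite !mxE !laplacian_entryE /= big_sumType /=.
rewrite [X in _ + X]big1 ?addr0 => [|q _]; last first.
  by rewrite big1 // => r _; rewrite mul0r.
apply: eq_bigr => k _; rewrite big_sumType /= [X in _ + X]big1 ?addr0 //.
by move=> r _; rewrite mulr0.
Qed.

(** Swapping the two incidences reverses an adjacency. New edges record non-adjacency in increasing
    order only; this gives the other order. *)
Lemma adjacentC : symmetric (adjacent G).
Proof.
suff imp v w : adjacent G v w -> adjacent G w v.
  by move=> v w; apply/idP/idP; apply: imp.
case/existsP=> p /and3P[bp /eqP <- /eqP <-].
case: (path1P p) => tp hp ep.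
have [q qt qh] := path1_of_inc (esym ep).
have [tq hq _] := path1P q.
apply/existsP; exists q; rewrite -tq -hq -tp -hp qt qh !eqxx /backstep qt qh.
by rewrite eq_sym bp.
Qed.

(** The walk from [v] to an adjacency of its component is empty or starts with an adjacency out of
    [v]. The incidence found provides a backstep at [v]. *)
Lemma component_incident : components_have_adjacency G ->
  forall v : V, exists i : incidence G, (Defs.iota i).1 = v.
Proof.
move=> hG v; have [p _ /andP[]] := hG v; rewrite !inE => /connectP[[|w s]] /=.
  by move=> _ <- _; exists (tail_inc p); case: (path1P p).
case/andP=> /existsP[q /and3P[_ /eqP <- _]] _ _ _.
by exists (tail_inc q); case: (path1P q).
Qed.

Lemma completion_path1 : components_have_adjacency G -> forall v w : V,
  exists2 p : path1_map (adjacency_completion G),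
    tail_vertex p = v & head_vertex p = w.
Proof.
move=> hG v w.
suff [i [j [<- <- /path1_of_inc[p <- <-]]]] :
    exists i j : incidence (adjacency_completion G),
      [/\ (Defs.iota i).1 = v, (Defs.iota j).1 = w &
          (Defs.iota i).2 = (Defs.iota j).2].
  by exists p; case: (path1P p).
have [avw|navw] := boolP (adjacent G v w).
  case/existsP: avw => p /and3P[_ /eqP <- /eqP <-].
  exists (inl (tail_inc p)), (inl (head_inc p)).
  by case: (path1P p) => /= -> -> ->.
have [lt_vw|lt_wv|<-] := ltgtP v w.
(* The Boolean selects the end of the new edge: [false] the smaller vertex, [true] the larger. *)
- have new : (v < w)%O && ~~ adjacent G v w by apply/andP.
  pose e : new_edge G := exist _ (v, w) new.
  by exists (inr (e, false)), (inr (e, true)).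
- have new : (w < v)%O && ~~ adjacent G w v by rewrite adjacentC; apply/andP.
  pose e : new_edge G := exist _ (w, v) new.
  by exists (inr (e, true)), (inr (e, false)).
(* A repeated incidence is a backstep. *)
- by have [i iv] := component_incident hG v; exists (inl i), (inl i).
Qed.

End Completion.

(** * Minors of the Laplacian and sub-contributors *)

Section Minors.
Variables (d : Order.disp_t) (V : finOrderType d).

Lemma Order_enum_val_onto (A : {set V}) (x : V) :
  x \in A -> exists i : 'I_#|A|, x = Order.enum_val i.
Proof.
move=> xA; exists (Order.enum_rank_in xA x).
by rewrite Order.EnumVal.enum_rankK_in.
Qed.

Lemma lt_Order_enum_val (A : {set V}) (i j : 'I_#|A|) :
  (Order.enum_val i < Order.enum_val j)%O = (i < j)%N.
Proof.
have le_mono := Order.EnumVal.le_enum_val (@le_total _ V) (A := A).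
by rewrite (leW_mono le_mono) ltEord.
Qed.

Variables (H : signed_incidence V) (U W : {set V}) (hUW : #|U| = #|W|).

Lemma row_vertex_subproof (i : 'I_#|~: U|) : Order.enum_val i \notin U.
Proof. by have := Order.EnumVal.enum_valP i; rewrite inE. Qed.

Definition row_vertex (i : 'I_#|~: U|) : {v : V | v \notin U} :=
  exist _ (Order.enum_val i) (row_vertex_subproof i).

(** Columns share the index type of the rows, so a permutation of the indices encodes a bijection
    from [~: U] to [~: W]. *)
Definition col_vertex (i : 'I_#|~: U|) : V :=
  Order.enum_val (cast_ord (card_setC_eq hUW) i).

Lemma row_vertex_inj : injective row_vertex.
Proof. by move=> i j /(congr1 val) /=; apply: Order.EnumVal.enum_val_inj. Qed.

Lemma row_vertex_bij : bijective row_vertex.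
Proof.
apply: inj_card_bij row_vertex_inj _; rewrite card_ord card_sig.
by apply/subset_leq_card/subsetP => v; rewrite !inE.
Qed.

Lemma col_vertex_inj : injective col_vertex.
Proof. by move=> i j /Order.EnumVal.enum_val_inj /cast_ord_inj. Qed.

Lemma col_vertex_onto w : w \notin W -> exists j, w = col_vertex j.
Proof.
rewrite -in_setC => /Order_enum_val_onto[j ->].
exists (cast_ord (esym (card_setC_eq hUW)) j).
by rewrite /col_vertex cast_ordKV.
Qed.

(** The tails must be constrained here because a [partial_map] leaves them free. *)
Definition realizes (s : 'S_#|~: U|) (c : partial_map H U) : bool :=
  [forall i, (tail_vertex (c (row_vertex i)) == val (row_vertex i)) &&
             (head_vertex (c (row_vertex i)) == col_vertex (s i))].

Lemma realizesP (s : 'S_#|~: U|) (c : partial_map H U) :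
  reflect
    (forall i, tail_vertex (c (row_vertex i)) = val (row_vertex i) /\
               head_vertex (c (row_vertex i)) = col_vertex (s i))
    (realizes s c).
Proof.
apply: (iffP forallP) => h i; have := h i; first by case/andP=> /eqP ? /eqP.
by case=> -> ->; rewrite !eqxx.
Qed.

Lemma realizes_uniq (s t : 'S_#|~: U|) (c : partial_map H U) :
  realizes s c -> realizes t c -> s = t.
Proof.
move=> /realizesP sc /realizesP tc; apply/permP => i.
by apply: col_vertex_inj; case: (sc i) (tc i) => _ <- [_ <-].
Qed.

(** Rows and columns are both listed increasingly, so order comparisons of vertices and of indices
    agree. *)
Lemma inversions_realizes (s : 'S_#|~: U|) (c : partial_map H U) :
  realizes s c ->
  inversions c =
  #|[set p : 'I_#|~: U| * 'I_#|~: U| | (p.1 < p.2)%N && (s p.2 < s p.1)%N]|.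
Proof.
move=> /realizesP sc; rewrite /inversions.
have [g gK Kg] := row_vertex_bij.
pose r2 (p : 'I_#|~: U| * 'I_#|~: U|) := (row_vertex p.1, row_vertex p.2).
have r2_bij : bijective r2.
  exists (fun q => (g q.1, g q.2)); first by case=> i j; rewrite /r2 /= !gK.
  by case=> x y; rewrite /r2 /= !Kg.
rewrite -(on_card_preimset (onW_bij _ r2_bij)); apply: eq_card => -[i j].
by rewrite !inE /= (sc i).2 (sc j).2 !lt_Order_enum_val.
Qed.

Hypothesis H_complete : forall v w : V,
  exists2 p : path1_map H, tail_vertex p = v & head_vertex p = w.

(** The heads of a contributor form a bijection of [V] taking [U] onto [W], hence one between the
    complements. Conversely, completeness of [H] supplies the removed paths. *)
Lemma subcontributorsE (c : partial_map H U) :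
  (c \in subcontributors H hUW) = [exists s, realizes s c].
Proof.
apply/imsetP/existsP => [[c0]|[s /realizesP sc]].
  rewrite inE => /andP[/andP[/forallP tc0 hc0] /forallP uw ->].
  have h_inj : injective (fun v => head_vertex (c0 v)).
    suff /imset_injP h : #|[set head_vertex (c0 v) | v : V]| == #|V|.
      by move=> v w; apply: h.
    by rewrite (eqP hc0) cardsT.
  (* A head in [W] is already the head of the path at some vertex of [U], so injectivity would put
     the row vertex in [U]. *)
  have col i : exists j, head_vertex (c0 (val (row_vertex i))) = col_vertex j.
    apply: col_vertex_onto; apply/negP => /Order_enum_val_onto[j hj].
    have := uw (cast_ord (esym hUW) j).
    rewrite cast_ordKV -hj => /eqP /h_inj /esym; apply/eqP.
    apply: contraNneq (valP (row_vertex i)) => ->.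
    exact: Order.EnumVal.enum_valP.
  have [f fP] := fin_all_exists col.
  have f_inj : injective f.
    move=> i j fij; apply: row_vertex_inj; apply: val_inj; apply: h_inj.
    by rewrite !fP fij.
  exists (perm f_inj); apply/realizesP => i; rewrite ffunE permE -fP.
  by rewrite (eqP (tc0 _)).
(* Of the last two conditions, one is vacuous according to whether [v] lies in [U]. *)
have ext v : exists p : path1_map H, [/\ tail_vertex p = v,
    forall x : {v : V | v \notin U}, val x = v -> p = c x &
    forall i : 'I_#|U|, Order.enum_val i = v ->
      head_vertex p = Order.enum_val (cast_ord hUW i)].
  have [vU|vU] := boolP (v \in U).
    have [i vi] := Order_enum_val_onto vU.
    have [p tp hp] := H_complete v (Order.enum_val (cast_ord hUW i)).
    exists p; split=> // [x xv|j]; first by have := valP x; rewrite /= xv vU.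
    by rewrite vi => /Order.EnumVal.enum_val_inj ->.
  have [g _ Kg] := row_vertex_bij.
  pose x : {v : V | v \notin U} := exist _ v vU.
  exists (c x); split=> [|y yv|i iv].
  - by rewrite -(Kg x) (sc _).1 Kg.
  - by congr (c _); apply: val_inj.
  - by have /negP[] := vU; rewrite -iv; apply: Order.EnumVal.enum_valP.
have [c0 c0P] := fin_all_exists ext.
exists (finfun c0); last first.
  by apply/ffunP => x; rewrite !ffunE; case: (c0P (val x)) => _ /(_ x erefl).
rewrite inE; apply/andP; split; last first.
  apply/forallP => i; rewrite ffunE.
  by case: (c0P (Order.enum_val i)) => _ _ /(_ i erefl) ->.
apply/andP; split.
  by apply/forallP => v; rewrite ffunE; case: (c0P v) => ->.
(* Vertices of [W] are reached by the added paths, the others through the inverse of [s]. *)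
rewrite eqEsubset subsetT /=; apply/subsetP => w _; apply/imsetP.
have [/Order_enum_val_onto[i ->]|/col_vertex_onto[j ->]] := boolP (w \in W).
  pose u := Order.enum_val (cast_ord (esym hUW) i); exists u => //.
  by rewrite ffunE; case: (c0P u) => _ _ /(_ _ erefl) ->; rewrite cast_ordKV.
pose v := val (row_vertex ((s^-1)%g j)); exists v => //.
rewrite ffunE; case: (c0P v) => _ /(_ _ erefl) -> _.
by rewrite (sc _).2 permKV.
Qed.

(** Distributivity: choosing one summand in each factor amounts to choosing a family [c] realizing
    [s]. *)
Lemma prod_minor (s : 'S_#|~: U|) :
  \prod_i delete_rows_cols hUW (laplacian H) i (s i) =
  \sum_(c | realizes s c) \prod_x - walk_sign [:: c x].
Proof.
have [g gK Kg] := row_vertex_bij.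
transitivity (\prod_x laplacian_entry H (val x) (col_vertex (s (g x)))).
  rewrite (reindex _ (onW_bij _ row_vertex_bij)); apply: eq_bigr => i _.
  by rewrite !mxE !Order.EnumVal.enum_rankK gK.
rewrite bigA_distr_big_dep; apply: eq_bigl => c; apply/familyP/realizesP.
  move=> h i; have := h (row_vertex i).
  by rewrite unfold_in gK => /andP[/eqP -> /eqP].
by move=> h x; rewrite unfold_in -(Kg x) (h _).1 (h _).2 !gK !eqxx.
Qed.

Hypothesis sigma01 : forall i : incidence H, sigma i \in [:: 0; 1; -1].

(** The weight [f] covers both formulas: the constant 1 gives the permanent, the sign of [s] the
    determinant. *)
Lemma weighted_minor_sum (f : 'S_#|~: U| -> int) (g : partial_map H U -> int) :
    (forall s c, realizes s c -> g c = f s) ->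
  \sum_(s : 'S_#|~: U|)
    f s * \prod_i delete_rows_cols hUW (laplacian H) i (s i) =
  \sum_(c in nonzero_subcontributors H hUW)
    g c * (-1) ^+ (odd_number c + negative_number c).
Proof.
move=> gf.
transitivity (\sum_(c : partial_map H U) \sum_(s | realizes s c)
                g c * \prod_x - walk_sign [:: c x]).
  rewrite (exchange_big_dep xpredT) //=; apply: eq_bigr => s _.
  by rewrite prod_minor big_distrr /=; apply: eq_bigr => c /gf ->.
rewrite [RHS]big_mkcond; apply: eq_bigr => c _; rewrite inE subcontributorsE.
have [/existsP[s sc]|/existsPn nc] /= := boolP [exists s, realizes s c];
  last first.
  by rewrite big_pred0 // => s; apply/negbTE/nc.
rewrite (big_pred1 s) => [|t]; last first.
  by apply/idP/eqP => [/realizes_uniq/(_ sc)|->].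
(* A family of sign 0 has a path of sign 0, so its weight vanishes too. *)
have [zc|nz] := eqVneq (partial_sign c) 0; last by rewrite partial_weightE.
have /eqP := zc; rewrite partial_signE => /prodf_eq0[x _ /eqP cx].
by rewrite (bigD1 x) //= cx oppr0 mul0r mulr0.
Qed.

End Minors.

Theorem theorem4p2 (d : Order.disp_t) (V : finOrderType d)
    (G : bidirected_graph V) (hG : components_have_adjacency G)
    (U W : {set V}) (hUW : #|U| = #|W|) :
  permanent (delete_rows_cols hUW (laplacian G)) =
    \sum_(c in nonzero_subcontributors (adjacency_completion G) hUW)
      (-1) ^+ (odd_number c + negative_number c)
  /\
  \det (delete_rows_cols hUW (laplacian G)) =
    \sum_(c in nonzero_subcontributors (adjacency_completion G) hUW)
      (-1) ^+ inversions c * (-1) ^+ (odd_number c + negative_number c).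
Proof.
have sum_minor := @weighted_minor_sum _ _ _ _ _ hUW
  (completion_path1 hG)
  (completion_sigma01 (@bg_sign _ G)).
(* The minor is expanded in the completion, where every required path exists. *)
rewrite -laplacian_completion; split.
  have := sum_minor (fun=> 1) (fun=> 1) (fun _ _ _ => erefl).
  under eq_bigr do rewrite mul1r.
  by under [X in _ = X -> _]eq_bigr do rewrite mul1r.
apply: sum_minor => s c /inversions_realizes ->.
by rewrite odd_perm_inversions.
Qed.
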